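(* Let $\Lambda_1,\Lambda_2,\ldots$ be positive random variables, let $N(t)$, $t\ge0$, be a standard Poisson process (unit intensity) independent of the sequence $(\Lambda_n)$, and set $N_n=N(\Lambda_n)$. Let $X_1,X_2,\ldots$ be i.i.d. random variables with $a=\mathsf{E}X_1\neq0$ and finite variance $\sigma^2=\mathsf{D}X_1$, and assume that for each $n$ the random variable $N_n$ is independent of $X_1,X_2,\ldots$ (empty sums are $0$). Let $(m_n)_{n\ge1}$ be a sequence of positive numbers with $m_n\to\infty$, and let $\Lambda$ be a random variable with $\Lambda_n/m_n\Rightarrow\Lambda$ as $n\to\infty$. Let $1\le s\le2$ and write $s=m+\alpha$ with $m$ a nonnegative integer and $0<\alpha\le1$. Then for every $n$ $$ \zeta_s\bigg(\frac{1}{am_n}\sum_{j=1}^{N(\Lambda_n)}X_j,\;\Lambda\bigg)\le\frac{\mathsf{E}\Lambda_n^{s/2}}{m_n^{s}}\cdot\frac{\Gamma(1+\alpha)}{\Gamma(1+s)}\Big(1+\frac{\sigma^2}{a^2}\Big)^{s/2}+\zeta_s\Big(\frac{\Lambda_n}{m_n},\,\Lambda\Big). $$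
   Context: For $s>0$ write uniquely $s=m+\alpha$ with $m$ a nonnegative integer and $0<\alpha\le 1$. $\mathcal{F}_s$ denotes the set of all real-valued bounded functions $f$ on $\mathbb{R}$ that are $m$ times differentiable and satisfy $|f^{(m)}(x)-f^{(m)}(y)|\le|x-y|^{\alpha}$ for all $x,y$. The Zolotarev metric is $\zeta_s(X,Y)=\sup\{|\mathsf{E}(f(X)-f(Y))|: f\in\mathcal{F}_s\}$ (it depends only on the marginal distributions of $X$ and $Y$). $\Rightarrow$ denotes convergence in distribution. *)

(* Defs.v *)
From HB Require Import structures.
From mathcomp Require Import all_boot all_order all_algebra.
From mathcomp Require Import all_classical all_reals all_analysis.
Set Implicit Arguments. Unset Strict Implicit. Unset Printing Implicit Defensive.
Import Order.TTheory GRing.Theory Num.Theory.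
Import numFieldNormedType.Exports.
Local Open Scope classical_set_scope.
Local Open Scope ring_scope.

Section Defs.
Context {R : realType}.

(* decomposition s = m + alpha, m nonnegative integer, 0 < alpha <= 1 (s > 0) *)
Definition zol_m (s : R) : nat := `|Num.ceil s - 1|%N.
Definition zol_alpha (s : R) : R := s - (zol_m s)%:R.

Definition zol_class (s : R) (f : R -> R) : Prop :=
  (exists M : R, forall x, `|f x| <= M) /\
  (forall k : nat, (k < zol_m s)%N -> forall x, derivable (derive1n k f) x 1) /\
  (forall x y, `|derive1n (zol_m s) f x - derive1n (zol_m s) f y|
                 <= powR `|x - y| (zol_alpha s)).

Definition zolotarev (s : R)
  {d1} {T1 : measurableType d1} (P1 : probability T1 R) (X : T1 -> R)
  {d2} {T2 : measurableType d2} (P2 : probability T2 R) (Y : T2 -> R) : \bar R :=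
  ereal_sup [set (`| fine (\int[P1]_w (f (X w))%:E)
                   - fine (\int[P2]_w (f (Y w))%:E) |)%:E | f in zol_class s].

Definition Gamma (x : R) : R :=
  fine (\int[@lebesgue_measure R]_(t in `]0%R, +oo[)
          (powR t (x - 1) * expR (- t))%:E).

Definition conv_distr
  {d1} {T1 : measurableType d1} (P1 : probability T1 R) (Y : nat -> T1 -> R)
  {d2} {T2 : measurableType d2} (P2 : probability T2 R) (L : T2 -> R) : Prop :=
  forall f : R -> R, continuous f -> (exists M : R, forall x, `|f x| <= M) ->
    (fun n => fine (\int[P1]_w (f (Y n w))%:E)) @ \oo
      --> fine (\int[P2]_w (f (L w))%:E).

Context {d} {T : measurableType d} (P : probability T R).

Definition sigma_of {I : Type} (D : set I) (X : I -> T -> R) : set (set T) :=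
  <<s setT, [set A | exists i, D i /\ exists B : set R,
                       measurable B /\ A = X i @^-1` B] >>.

Definition indep_sigma (F G : set (set T)) : Prop :=
  forall A B, F A -> G B -> P (A `&` B) = (P A * P B)%E.

Definition indep_fam (n : nat) (Y : 'I_n -> T -> R) : Prop :=
  forall B : 'I_n -> set R, (forall i, measurable (B i)) ->
    P (\bigcap_(i in [set: 'I_n]) (Y i @^-1` B i)) =
    (\prod_(i < n) fine (P (Y i @^-1` B i)))%:E.

Definition iid (X : nat -> T -> R) : Prop :=
  (forall j, measurable_fun setT (X j)) /\
  (forall n, indep_fam (fun i : 'I_n => X i)) /\
  (forall j (B : set R), measurable B -> P (X j @^-1` B) = P (X 0%N @^-1` B)).

Definition poisson_process (N : R -> T -> nat) : Prop :=
  (forall t, measurable_fun setT (fun w => (N t w)%:R : R)) /\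
  (forall w, N 0 w = 0%N) /\
  (forall w s t, 0 <= s -> s <= t -> (N s w <= N t w)%N) /\
  (forall w t, 0 <= t -> exists2 e : R, 0 < e &
       forall u, t <= u -> u < t + e -> N u w = N t w) /\
  (forall s t (k : nat), 0 <= s -> s <= t ->
     P [set w | (N t w - N s w)%N = k] =
       (expR (- (t - s)) * (t - s) ^+ k / (k`!)%:R)%:E) /\
  (forall n (t : nat -> R), 0 <= t 0%N -> (forall i, t i <= t i.+1) ->
     indep_fam (fun i : 'I_n => fun w => ((N (t i.+1) w - N (t i) w)%N)%:R)).

End Defs.

(* Main.v *)
Require Import Defs.
From HB Require Import structures.
From mathcomp Require Import all_boot all_order all_algebra.
From mathcomp Require Import all_classical all_reals all_analysis.
From mathcomp Require Import measurable_realfun ring lra.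
Import Order.TTheory GRing.Theory Num.Theory.
Import numFieldNormedType.Exports.
Local Open Scope classical_set_scope.
Local Open Scope ring_scope.
Set Implicit Arguments.
Unset Strict Implicit.
Unset Printing Implicit Defensive.

(** The distance depends only on marginal laws, so N(Lambda_n) may be replaced
    by the mixed Poisson law P(N(Lambda_n) = k) = E[e^-L L^k / k!] with
    L = Lambda_n, and E f(S_N / (a m)) becomes the expectation of
    H(L) = sum_k e^-L L^k / k! E f(S_k / (a m)).  For a fixed value x of L,
    expand f at y = x / m to first order; the remainder is at most
    Gamma(1+alpha)/Gamma(1+s) |.|^s.  The first-order term has mean zero because
    the compound Poisson sum has mean a x, and the remainder is controlled by
    the variance v = x (1 + sigma^2/a^2) / m^2 of that sum, which gives
    |H(x) - f(x / m)| <= Gamma(1+alpha)/Gamma(1+s) v^(s/2).  Integrating in L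
    and using the triangle inequality through Lambda_n / m_n concludes. *)

(** For [s < 2] the mean of |u|^s under a compound Poisson law has no closed form. By concavity of
    w^(s/2), |u|^s lies below the tangent line at w = v, taken at w = u^2, and this line is affine
    in u^2. With v the variance of the normalised compound sum, averaging the line gives exactly
    v^(s/2), so no constant is lost and only first and second moments of X and of the Poisson law
    are computed. The constant Gamma(1+alpha)/Gamma(1+s) equals 1 at [s = 1] and 1/s for
    [1 < s <= 2]. The value 1/s is what integrating t^(s-1) produces in the Taylor remainder.
    Independence is given in two separate pieces: the process from the sequence of Lambdas, and
    N(Lambda_n) from X. Hence there is no conditioning on Lambda_n. The mean of 1{N(Lambda_n) = k}
    f(S_k / (a m)) is factored first, then the probability of N(Lambda_n) = k is rewritten as a
    mixed Poisson weight. Since [N t] is measurable for each fixed time, evaluation at a random time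
    passes through times with countably many values. *)

(** * First-order Taylor remainder for a function with Hoelder derivative *)

Section Taylor.
Context {R : realType}.
Implicit Types f g : R -> R.

(** The difference [h] of the two sides has nonpositive derivative at positive points. Powers are
    differentiated only there, so the endpoint 0 is reached by right continuity. *)
Lemma le_powR_of_derive_le (al : R) g : 0 < al -> (forall x : R, derivable g x 1) ->
  g 0 = 0 -> (forall t : R, 0 < t -> derive1 g t <= t `^ al) ->
  forall t : R, 0 <= t -> g t <= t `^ (1 + al) / (1 + al).
Proof.
move=> al0 dg g0 g'le t; rewrite le_eqVlt => /predU1P[<-|t0].
  by rewrite g0 divr_ge0 ?powR_ge0//; lra.
have al10 : 0 < 1 + al by lra.
pose h (x : R) := g x - (1 + al)^-1 * x `^ (1 + al).
have dh (x : R) : 0 < x -> is_derive x 1 h (derive1 g x - x `^ al).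
  move=> x0.
  have hg : is_derive x 1 g (derive1 g x) by rewrite derive1E; exact: DeriveDef.
  have hp := is_derive1_powR (1 + al) x0.
  have -> : derive1 g x - x `^ al
          = derive1 g x - (1 + al)^-1 *: ((1 + al) * x `^ (1 + al - 1)).
    have -> : 1 + al - 1 = al by lra.
    by rewrite scalerA mulVf ?gt_eqF// scale1r.
  exact: is_deriveB.
have : h t <= h 0.
  apply: (@ler0_derive1_le_cc _ h 0 t) => //.
  - by move=> x; rewrite in_itv/= => /andP[x0 _]; case: (dh _ x0).
  - move=> x; rewrite in_itv/= => /andP[x0 _].
    by rewrite derive1E; have [_ ->] := dh _ x0; rewrite subr_le0 g'le.
  - have ch (x : R) : 0 < x -> {for x, continuous h}.
      move=> x0; apply: differentiable_continuous; apply/derivable1_diffP.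
      by case: (dh _ x0).
    apply/(continuous_within_itvP _ t0); split.
    + by move=> x; rewrite in_itv/= => /andP[/ch].
    + rewrite /h; apply: cvgB.
        apply: cvg_at_right_filter; apply: differentiable_continuous.
        exact/derivable1_diffP.
      apply: cvgM; first exact: cvg_cst.
      by rewrite powR0 ?gt_eqF//; exact: powR_cvg0.
    + by apply: cvg_at_left_filter; exact: ch.
  - by rewrite in_itv/= lexx ltW.
  - by rewrite in_itv/= lexx ltW.
  - by rewrite ltW.
by rewrite /h g0 powR0 ?gt_eqF// mulr0 subr0 subr_le0 mulrC.
Qed.

(** The one-sided comparison is applied along the ray from [y] towards [x]. In [key] the sign [d]
    selects the direction of the ray and the sign [e] selects which half of the absolute value is
    bounded. *)
Lemma taylor_hoelder (al : R) f : 0 < al -> (forall x : R, derivable f x 1) ->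
  (forall x y, `|derive1 f x - derive1 f y| <= `|x - y| `^ al) ->
  forall x y, `|f x - f y - derive1 f y * (x - y)| <= `|x - y| `^ (1 + al) / (1 + al).
Proof.
move=> al0 df hf.
have key (e d y t : R) : `|e| = 1 -> `|d| = 1 -> 0 <= t ->
    e * (f (y + d * t) - f y - derive1 f y * (d * t)) <= t `^ (1 + al) / (1 + al).
  move=> e1 d1; move: t.
  pose g (t : R) := e * (f (y + d * t) - f y - derive1 f y * (d * t)).
  have dg (t : R) : is_derive t 1 g (e * d * (derive1 f (y + d * t) - derive1 f y)).
    have hl : is_derive t 1 (fun t : R => y + d * t) d.
      have H := is_deriveD (is_derive_cst y t 1) (is_deriveZ d (is_derive_id t (1 : R))).
      by apply: (is_derive_eq H); rewrite add0r /GRing.scale/= mulr1.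
    have hf' : is_derive (y + d * t) 1 f (derive1 f (y + d * t)).
      by rewrite derive1E; exact: DeriveDef.
    have hc := @is_derive1_comp _ f (fun t : R => y + d * t) t _ _ hf' hl.
    have H := is_deriveZ e (is_deriveB (is_deriveB hc (is_derive_cst (f y) t 1))
      (is_deriveZ (derive1 f y) (is_deriveZ d (is_derive_id t (1 : R))))).
    by apply: (is_derive_eq H); rewrite /GRing.scale/=; ring.
  apply: (@le_powR_of_derive_le al g) => //.
  - by rewrite /g mulr0 addr0 mulr0; ring.
  - move=> t t0; rewrite derive1E; have [_ ->] := dg t.
    apply: (le_trans (ler_norm _)); rewrite !normrM e1 d1 !mul1r.
    apply: (le_trans (hf _ _)).
    by rewrite addrAC subrr add0r normrM d1 mul1r ger0_norm// ltW.
move=> x y; set d : R := if y <= x then 1 else -1.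
have d1 : `|d| = 1 by rewrite /d; case: ifP; rewrite ?normrN ?normr1.
have dE : x - y = d * `|x - y|.
  rewrite /d; case: ifPn => [yx|]; first by rewrite ger0_norm ?mul1r// subr_ge0.
  by rewrite -ltNge => xy; rewrite ltr0_norm ?subr_lt0// mulN1r opprK.
have xE : x = y + d * `|x - y| by rewrite -dE addrC subrK.
rewrite ler_norml; apply/andP; split.
  have := @key (-1) d y `|x - y| (normrN1 _) d1 (normr_ge0 _).
  by rewrite -xE -dE mulN1r lerNl.
have := @key 1 d y `|x - y| (normr1 _) d1 (normr_ge0 _).
by rewrite -xE -dE mul1r.
Qed.

End Taylor.

(** * Finiteness, positivity and recursion of the Gamma integral *)

Section GammaFacts.
Context {R : realType}.
Notation mu := (@lebesgue_measure R).

(** The cubic term of the exponential series outgrows C x^2. This disposes of the boundary terms at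
    infinity in the integrations below. *)
Lemma cvg_mul_expRN_le_sqr (h : R -> R) (C : R) :
  (forall x, 1 <= x -> 0 <= h x <= C * x ^+ 2) ->
  h x * expR (- x) @[x --> +oo] --> 0.
Proof.
move=> hC; have C0 : 0 <= C.
  by have /andP[h0] := hC 1 (lexx _); rewrite expr1n mulr1; exact: le_trans.
apply/cvgrPdist_le => e e0; near=> x.
have x1 : 1 <= x by near: x; apply: nbhs_pinfty_ge; rewrite num_real.
have x0 : 0 < x by lra.
(* This threshold is exactly the condition C x^2 <= e (x^3 / 6). *)
have xe : C * 6 / e <= x by near: x; apply: nbhs_pinfty_ge; rewrite num_real.
have /andP[h0 hle] := hC x x1.
rewrite sub0r normrN ger0_norm ?mulr_ge0 ?expR_ge0//.
have ex : x ^+ 3 / 6 <= expR x.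
  have := @expR_ge1Dxn R x 2 (ltW x0); rewrite (_ : 3`! = 6)%N//.
  by apply: le_trans; rewrite lerDr.
rewrite expRN ler_pdivrMr ?expR_gt0//; apply: (le_trans hle).
apply: (@le_trans _ _ (e * (x ^+ 3 / 6))); last by rewrite ler_pM2l.
have -> : e * (x ^+ 3 / 6) = (e * x / 6) * x ^+ 2 by field.
rewrite ler_wpM2r ?sqr_ge0//.
by move: xe; rewrite ler_pdivrMr// ler_pdivlMr// [x * e]mulrC.
Unshelve. all: by end_near. Qed.

(** Kept in the extended reals: [Gamma] applies [fine], which sends an infinite value to 0, so
    finiteness must be known before an identity is transferred. *)
Definition Gamma_int (p : R) : \bar R :=
  (\int[mu]_(t in `]0%R, +oo[) (t `^ p * expR (- t))%:E)%E.

Lemma GammaE x : Gamma x = fine (Gamma_int (x - 1)). Proof. by []. Qed.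

Lemma is_derive_expRN (x : R) : is_derive x 1 (fun x : R => expR (- x)) (- expR (- x)).
Proof.
have H := @is_derive1_comp _ expR (fun t : R => - t) x _ _ (is_derive_expR _)
  (is_deriveN (is_derive_id x 1)).
by apply: (is_derive_eq H); rewrite mulrN1.
Qed.

Lemma continuous_expRN : continuous (fun x : R => expR (- x)).
Proof.
move=> x; apply: differentiable_continuous; apply/derivable1_diffP.
by case: (is_derive_expRN x).
Qed.

Lemma measurable_powR_expRN (p : R) (D : set R) :
  measurable_fun D (EFin \o (fun t : R => t `^ p * expR (- t))).
Proof.
apply: measurable_funTS; apply/measurable_EFinP; apply: measurable_funM.
  exact: measurable_powR.
exact: continuous_measurable_fun continuous_expRN.
Qed.

(** The weight (1 + t^2) e^-t dominates t^p e^-t for all 0 <= p <= 2, so this single explicit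
    integral gives finiteness of all the Gamma integrals in use. *)
Lemma integral_sqr_expRN :
  (\int[mu]_(t in `]0%R, +oo[) ((1 + t ^+ 2) * expR (- t))%:E = 3%:E)%E.
Proof.
have cw : continuous (fun t : R => (1 + t ^+ 2) * expR (- t)).
  move=> x; apply: cvgM; last exact: continuous_expRN.
  by apply: cvgD; [exact: cvg_cst|exact: exprn_continuous].
rewrite integral_itv_obnd_cbnd; last first.
  by apply: measurable_funTS; apply/measurable_EFinP; exact: continuous_measurable_fun.
pose W (t : R) := - ((t ^+ 2 + 2 * t + 3) * expR (- t)).
have dW (t : R) : is_derive t 1 W ((1 + t ^+ 2) * expR (- t)).
  have H := is_deriveN (is_deriveM (is_deriveD
      (is_deriveD (is_deriveX 2 (is_derive_id t (1:R)))
        (is_deriveZ (2 : R) (is_derive_id t (1:R))))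
      (is_derive_cst (3 : R) t 1)) (is_derive_expRN t)).
  by apply: (is_derive_eq H); rewrite !fctE /= /GRing.scale/=; ring.
rewrite (@ge0_continuous_FTC2y _ _ W _ 0)//.
- by rewrite /W oppr0 expR0 -EFinB; congr EFin; lra.
- by move=> x _; rewrite mulr_ge0 ?expR_ge0// addr_ge0// sqr_ge0.
- exact: continuous_subspaceT.
(* The constant is 6 = 1 + 2 + 3, because t^2 + 2t + 3 <= 6 t^2 for t >= 1. *)
- rewrite -oppr0; apply: cvgN; apply: (@cvg_mul_expRN_le_sqr _ 6) => x x1.
  by nra.
- apply: cvg_at_right_filter; apply: differentiable_continuous.
  by apply/derivable1_diffP; case: (dW 0).
- by move=> x _; rewrite derive1E; case: (dW x).
Qed.

Lemma powR_le_1Dsqr (p t : R) : 0 <= p <= 2 -> 0 <= t -> t `^ p <= 1 + t ^+ 2.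
Proof.
move=> /andP[p0 p2] t0; have [t1|t1] := leP t 1.
  (* At [t = 0] the convention 0^0 = 1 matters: for [p = 0] the bound is an equality. *)
  have [->|tn0] := eqVneq t 0.
    have [->|/powR0 ->] := eqVneq p 0; rewrite ?powRr0 expr0n/=; lra.
  apply: (@le_trans _ _ 1); last by rewrite lerDl sqr_ge0.
  by rewrite -(powRr0 t); apply: ger_powR => //; rewrite t1 lt_def tn0 t0.
apply: (@le_trans _ _ (t ^+ 2)); last by lra.
by rewrite -powR_mulrn// ler_powR// ltW.
Qed.

Lemma Gamma_int_lty (p : R) : 0 <= p <= 2 -> (Gamma_int p < +oo)%E.
Proof.
move=> p02; apply: (@le_lt_trans _ _ 3%:E); last by rewrite ltry.
rewrite -integral_sqr_expRN; apply: ge0_le_integral => //.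
- by move=> x _; rewrite lee_fin mulr_ge0 ?powR_ge0 ?expR_ge0.
- exact: measurable_powR_expRN.
- apply: measurable_funTS; apply/measurable_EFinP.
  apply: measurable_funM; last exact: continuous_measurable_fun continuous_expRN.
  by apply: measurable_funD => //; exact: exprn_measurable.
- move=> x; rewrite /= in_itv/= andbT => x0.
  by rewrite lee_fin ler_wpM2r ?expR_ge0// powR_le_1Dsqr// ltW.
Qed.

(** On [1, 2] one has t^p >= 1 and e^-t >= e^-2, and this interval has length 1. *)
Lemma Gamma_int_gt0 (p : R) : 0 <= p -> (0 < Gamma_int p)%E.
Proof.
move=> p0; apply: (@lt_le_trans _ _ (expR (- 2))%:E); first by rewrite lte_fin expR_gt0.
apply: (@le_trans _ _ (\int[mu]_(t in `[1%R, 2%R]) (expR (- 2))%:E)%E).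
  rewrite integral_cst//= lebesgue_measure_itv/= lte_fin ltr1n -EFinB -EFinM.
  by rewrite lee_fin; lra.
apply: (@le_trans _ _ (\int[mu]_(t in `[1%R, 2%R]) (t `^ p * expR (- t))%:E)%E).
  apply: ge0_le_integral => //.
  - exact: measurable_powR_expRN.
  - move=> x; rewrite /= in_itv/= => /andP[x1 x2]; rewrite lee_fin.
    rewrite -[leLHS]mul1r ler_pM ?expR_ge0// ?ler_expR ?lerN2//.
    by rewrite -(powRr0 x) ler_powR.
apply: ge0_subset_integral => //.
- exact: measurable_powR_expRN.
- by move=> x _; rewrite lee_fin mulr_ge0 ?powR_ge0 ?expR_ge0.
- by move=> x; rewrite /= !in_itv/= => /andP[x1 _]; rewrite andbT; lra.
Qed.

(* Adding (1 + t^2) e^-t makes the derivative of t^s e^-t nonnegative, so that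
   the fundamental theorem on [0, +oo[ applies to it. *)
Lemma Gamma_int_rec (s : R) : 1 < s <= 2 -> Gamma_int s = (s%:E * Gamma_int (s - 1))%E.
Proof.
move=> /andP[s1 s2]; have s0 : 0 < s by lra.
pose w (t : R) := (1 + t ^+ 2) * expR (- t).
pose f (t : R) := s * (t `^ (s - 1) * expR (- t)) + (1 + t ^+ 2 - t `^ s) * expR (- t).
(* [F] is t^s e^-t plus the antiderivative of (1 + t^2) e^-t, so its derivative is [f], and
   [F 0 = -3]. *)
pose F (t : R) := t `^ s * expR (- t) - (t ^+ 2 + 2 * t + 3) * expR (- t).
have mw (D : set R) : measurable_fun D (EFin \o w).
  apply: measurable_funTS; apply/measurable_EFinP.
  apply: measurable_funM; last exact: continuous_measurable_fun continuous_expRN.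
  by apply: measurable_funD => //; exact: exprn_measurable.
have mf (D : set R) : measurable_fun D (EFin \o f).
  apply: measurable_funTS; apply/measurable_EFinP.
  apply: measurable_funD; apply: measurable_funM => //.
  - apply: measurable_funM; first exact: measurable_powR.
    exact: continuous_measurable_fun continuous_expRN.
  - apply: measurable_funB; last exact: measurable_powR.
    by apply: measurable_funD => //; exact: exprn_measurable.
  - exact: continuous_measurable_fun continuous_expRN.
have f0 t : 0 <= t -> 0 <= f t.
  move=> t0; rewrite addr_ge0// mulr_ge0 ?expR_ge0// ?(ltW s0)//.
    by rewrite mulr_ge0 ?powR_ge0 ?expR_ge0.
  by rewrite subr_ge0 powR_le_1Dsqr// s2 ltW.
have dF (t : R) : 0 < t -> is_derive t 1 F (f t).
  move=> t0.
  have H := is_deriveB (is_deriveM (is_derive1_powR s t0) (is_derive_expRN t))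
   (is_deriveM (is_deriveD
      (is_deriveD (is_deriveX 2 (is_derive_id t (1:R)))
        (is_deriveZ (2 : R) (is_derive_id t (1:R))))
      (is_derive_cst (3 : R) t 1)) (is_derive_expRN t)).
  by apply: (is_derive_eq H); rewrite /f !fctE /= /GRing.scale/=; ring.
have cp (p t : R) : 0 < t -> {for t, continuous (fun t : R => t `^ p)}.
  move=> t0; apply: differentiable_continuous; apply/derivable1_diffP.
  by apply: derivable_powR; rewrite in_itv/= andbT.
have cw : continuous (fun t : R => 1 + t ^+ 2).
  by move=> x; apply: cvgD; [exact: cvg_cst|exact: exprn_continuous].
have If : (\int[mu]_(t in `]0%R, +oo[) (f t)%:E = 3%:E)%E.
  rewrite integral_itv_obnd_cbnd//.
  rewrite (@ge0_continuous_FTC2y _ _ F _ 0)//.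
  - by rewrite /F oppr0 expR0 powR0 ?gt_eqF// -EFinB; congr EFin; lra.
  - apply/continuous_within_itvcyP; split.
      move=> x; rewrite in_itv/= andbT => x0.
      apply: cvgD; apply: cvgM => //; try exact: continuous_expRN.
      - exact: cvg_cst.
      - by apply: cvgM; [exact: cp|exact: continuous_expRN].
      - by apply: cvgB; [exact: cw|exact: cp].
    have cpr (p : R) : 0 < p -> t `^ p @[t --> 0^'+] --> (0 : R) `^ p.
      by move=> p0; rewrite powR0 ?gt_eqF//; exact: powR_cvg0.
    have cer : expR (- t) @[t --> (0:R)^'+] --> expR (- (0:R)).
      by apply: cvg_at_right_filter; exact: continuous_expRN.
    apply: cvgD; apply: cvgM => //; first exact: cvg_cst.
    + by apply: cvgM => //; apply: cpr; lra.
    + apply: cvgB; last exact: cpr.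
      by apply: cvg_at_right_filter; exact: cw.
  - have -> : 0 = 0 - 0 :> R by rewrite subr0.
    apply: cvgB.
      apply: (@cvg_mul_expRN_le_sqr _ 2) => x x1; rewrite powR_ge0/=.
      apply: (@le_trans _ _ (1 + x ^+ 2)); last by nra.
      by apply: powR_le_1Dsqr; [rewrite s2 ltW|lra].
    by apply: (@cvg_mul_expRN_le_sqr _ 6) => x x1; nra.
  - by move=> x /dF[].
  - rewrite /F; apply: cvgB.
      apply: cvgM; last by apply: cvg_at_right_filter; exact: continuous_expRN.
      by rewrite powR0 ?gt_eqF//; exact: powR_cvg0.
    apply: cvg_at_right_filter; apply: cvgM; last exact: continuous_expRN.
    apply: cvgD; last exact: cvg_cst.
    apply: cvgD; first exact: exprn_continuous.
    by apply: cvgM; [exact: cvg_cst|].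
  - by move=> x; rewrite in_itv/= andbT derive1E => /dF[].
(* The two 3's come from different integrals, that of (1 + t^2) e^-t and that of [f]. Both sides
   then have the same integrand, all sums are of nonnegative functions, and the finite 3 is
   cancelled afterwards. *)
have E : (s%:E * Gamma_int (s - 1) + 3%:E = 3%:E + Gamma_int s)%E.
  rewrite -{1}integral_sqr_expRN -If /Gamma_int.
  rewrite -ge0_integralZl//; last 3 first.
  - exact: measurable_powR_expRN.
  - by move=> x _; rewrite lee_fin mulr_ge0 ?powR_ge0 ?expR_ge0.
  - by rewrite lee_fin ltW.
  rewrite -ge0_integralD//; last 4 first.
  - by move=> x _; rewrite -EFinM lee_fin mulr_ge0 ?(ltW s0)// mulr_ge0 ?powR_ge0 ?expR_ge0.
  - by apply: measurable_funeM; exact: measurable_powR_expRN.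
  - by move=> x _; rewrite lee_fin mulr_ge0 ?expR_ge0// addr_ge0// sqr_ge0.
  - exact: mw.
  rewrite -ge0_integralD//; last 4 first.
  - by move=> x; rewrite /= in_itv/= andbT => x0; rewrite lee_fin f0// ltW.
  - exact: mf.
  - by move=> x _; rewrite lee_fin mulr_ge0 ?powR_ge0 ?expR_ge0.
  - exact: measurable_powR_expRN.
  by apply: eq_integral => x _; rewrite -EFinM -!EFinD /f; congr EFin; ring.
by move: E; rewrite addeC => /(congr1 (fun x => x - 3%:E)%E); rewrite ![(3%:E + _)%E]addeC !addeK.
Qed.

Lemma Gamma_gt0 (x : R) : 1 <= x <= 3 -> 0 < Gamma x.
Proof.
move=> /andP[x1 x3]; rewrite GammaE fine_gt0// Gamma_int_gt0/= ?Gamma_int_lty//; lra.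
Qed.

Lemma Gamma_rec (s : R) : 1 < s <= 2 -> Gamma (1 + s) = s * Gamma s.
Proof.
move=> s12; rewrite !GammaE addrAC subrr add0r Gamma_int_rec// fineM//.
by rewrite ge0_fin_numE ?ltW ?Gamma_int_gt0 ?Gamma_int_lty//; lra.
Qed.

End GammaFacts.

(** * Test functions of the Zolotarev metric for orders between 1 and 2 *)

Section ZolotarevClass.
Context {R : realType}.
Implicit Types (s : R) (f : R -> R).

(** Because alpha may be 1 but not 0, the order 1 has m = 0 and alpha = 1, while all of ]1, 2],
    endpoint 2 included, has m = 1. This is the origin of the case splits at [s = 1]. *)
Lemma zol_m1 : zol_m (1 : R) = 0%N.
Proof. by rewrite /zol_m (_ : Num.ceil 1 = 1) ?ceil1. Qed.

Lemma zol_m_gt1 s : 1 < s <= 2 -> zol_m s = 1%N.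
Proof.
move=> /andP[s1 s2]; rewrite /zol_m (_ : Num.ceil s = 2)//.
by apply: ceil_def; rewrite s2 andbT.
Qed.

Lemma zol_class_continuous s f : 1 <= s <= 2 -> zol_class s f -> continuous f.
Proof.
move=> /andP[]; rewrite le_eqVlt => /predU1P[<- _|s1 s2].
  move=> [_ [_]]; rewrite /zol_alpha zol_m1 subr0 => fL x.
  apply/cvgrPdist_le => e e0; apply: filterS (nbhsx_ballx x e e0) => y.
  rewrite -ball_normE /= => /ltW xy.
  by apply: (le_trans (fL _ _)); rewrite powRr1.
move=> [_ [+ _]]; rewrite zol_m_gt1 ?s1// => /(_ 0%N isT) /= df x.
by apply: differentiable_continuous; exact/derivable1_diffP.
Qed.

(** An existential slope [D] unites two cases. At [s = 1] the Gamma ratio is 1, [D = 0] and the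
    bound is the Lipschitz condition. For [s > 1] the ratio is 1/s and [D] is the derivative at
    [y]. *)
Lemma zol_class_taylor s f : 1 <= s <= 2 -> zol_class s f ->
  forall y, exists D, forall x, `|f x - f y - D * (x - y)| <=
    Gamma (1 + zol_alpha s) / Gamma (1 + s) * `|x - y| `^ s.
Proof.
move=> /andP[]; rewrite le_eqVlt => /predU1P[<- _|s1 s2].
  move=> [_ [_]]; rewrite /zol_alpha zol_m1 subr0 => fL y.
  exists 0 => x; rewrite mul0r subr0 divff ?mul1r//.
  by rewrite gt_eqF// Gamma_gt0//; lra.
move=> [_ []]; rewrite /zol_alpha zol_m_gt1 ?s1//= => df hf y.
exists (derive1 f y) => x.
have -> : 1 + (s - 1) = s by lra.
rewrite Gamma_rec ?s1// invfM mulrCA divff ?mulr1; last first.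
  by rewrite gt_eqF// Gamma_gt0//; lra.
have s10 : 0 < s - 1 by lra.
have := taylor_hoelder s10 (df 0%N isT) hf x y.
by rewrite (_ : 1 + (s - 1) = s) ?[_ / s]mulrC//; lra.
Qed.

(* Young's inequality: it replaces the Hoelder bound E|U|^s <= (E U^2)^(s/2) by
   a pointwise one, in which the optimal v is E U^2. *)
Lemma powR_le_quadratic s (u v : R) : 1 <= s <= 2 -> 0 < v ->
  `|u| `^ s <= v `^ (s / 2 - 1) * (s / 2 * u ^+ 2 + (1 - s / 2) * v).
Proof.
move=> /andP[s1]; rewrite le_eqVlt => /predU1P[->|s2] v0.
  rewrite divff// subrr powRr0 mul0r addr0 !mul1r.
  by rewrite powR_mulrn// real_normK// num_real.
set p := s / 2; have p0 : 0 < p by rewrite /p; lra.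
have p1 : 0 < 1 - p by rewrite /p; lra.
(* The conjugate exponents are 1/p and 1/(1 - p), which exist only for [s < 2]. They turn the
   factors |u|^s and v^(1-p) into u^2 and v, and multiplying by v^(p-1) afterwards removes the
   second factor on the left. *)
have := @conjugate_powR R (`|u| `^ s) (v `^ (1 - p)) p^-1 (1 - p)^-1 (powR_ge0 _ _) (powR_ge0 _ _).
rewrite !invr_gt0 !invrK => /(_ p0 p1); rewrite addrC subrK => /(_ erefl).
rewrite -!powRrM divff ?gt_eqF// powRr1 ?(ltW v0)//.
have -> : s / p = 2 by rewrite /p; field; lra.
rewrite powR_mulrn// real_normK ?num_real// => H.
have -> : `|u| `^ s = v `^ (p - 1) * (`|u| `^ s * v `^ (1 - p)).
  rewrite mulrCA -powRD; last by apply/implyP => _; rewrite gt_eqF.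
  by rewrite (_ : p - 1 + (1 - p) = 0) ?powRr0 ?mulr1//; lra.
by rewrite ler_wpM2l ?powR_ge0//; lra.
Qed.

End ZolotarevClass.

(** * Series for the first two moments of the Poisson law *)

Section PoissonMoments.
Context {R : realType}.
Implicit Types (l : R) (u : nat -> R).

Definition pois l (k : nat) : R := expR (- l) * l ^+ k / k`!%:R.

Lemma pois_ge0 l k : 0 <= l -> 0 <= pois l k.
Proof. by move=> l0; rewrite divr_ge0// mulr_ge0 ?expR_ge0 ?exprn_ge0. Qed.

Lemma cvg_series_pois l : series (pois l) @ \oo --> (1 : R).
Proof.
have -> : series (pois l) = (fun n => expR (- l) * series (exp_coeff l) n).
  apply/funext => n; rewrite /series/= mulr_sumr; apply: eq_bigr => k _.
  by rewrite /pois /exp_coeff mulrA.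
rewrite -(expRxMexpNx_1 l) mulrC; apply: cvgM; first exact: cvg_cst.
exact: is_cvg_series_exp_coeff.
Qed.

Lemma cvg_series_shift u (x : R) :
  series (fun k => u k.+1) @ \oo --> x -> series u @ \oo --> u 0%N + x.
Proof.
move=> ux; rewrite -cvg_shiftS /=.
have -> : (fun n => series u n.+1) = (fun n => u 0%N + series (fun k => u k.+1) n).
  by apply/funext => n; rewrite /series/= big_nat_recl.
by apply: cvgD => //; exact: cvg_cst.
Qed.

(** Size-biasing: a factor k shifts the index by one, which reduces each moment to lower ones. *)
Lemma poisS l k : pois l k.+1 * k.+1%:R = l * pois l k.
Proof.
rewrite /pois factS natrM exprS; field.
by rewrite nat1r !pnatr_eq0 -lt0n fact_gt0.
Qed.

Lemma cvg_series_pois_mean l : series (fun k => pois l k * k%:R) @ \oo --> l.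
Proof.
have : series (fun k => pois l k.+1 * k.+1%:R) @ \oo --> l.
  have -> : series (fun k => pois l k.+1 * k.+1%:R) = (fun n => l * series (pois l) n).
    apply/funext => n; rewrite /series/= mulr_sumr.
    by apply: eq_bigr => k _; rewrite poisS.
  rewrite -[X in _ --> X]mulr1; apply: cvgM; first exact: cvg_cst.
  exact: cvg_series_pois.
by move=> /(cvg_series_shift (u := fun k => pois l k * k%:R)); rewrite mulr0 add0r.
Qed.

Lemma cvg_series_pois_sqr l :
  series (fun k => pois l k * k%:R ^+ 2) @ \oo --> l ^+ 2 + l.
Proof.
have : series (fun k => pois l k.+1 * k.+1%:R ^+ 2) @ \oo --> l ^+ 2 + l.
  have -> : series (fun k => pois l k.+1 * k.+1%:R ^+ 2) =
      (fun n => l * (series (fun k => pois l k * k%:R) n + series (pois l) n)).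
    apply/funext => n; rewrite /series/= -big_split/= mulr_sumr.
    apply: eq_bigr => k _; rewrite expr2 mulrA poisS -mulrA; congr (_ * _).
    by rewrite -natr1 mulrDr mulr1.
  have -> : l ^+ 2 + l = l * (l + 1) by rewrite mulrDr mulr1 expr2.
  apply: cvgM; first exact: cvg_cst.
  by apply: cvgD; [exact: cvg_series_pois_mean|exact: cvg_series_pois].
move=> /(cvg_series_shift (u := fun k => pois l k * k%:R ^+ 2)).
by rewrite expr0n/= mulr0 add0r.
Qed.

(** This is the shape of the second moment of a sum of k terms: [be] carries the variance of the
    summands and [ga] the squared deviation of the count from its mean. The limit uses that the
    Poisson variance is [l]. *)
Lemma cvg_series_pois_quad l (al be ga : R) :
  series (fun k => pois l k * (al + be * k%:R + ga * (k%:R - l) ^+ 2)) @ \oo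
    --> al + be * l + ga * l.
Proof.
have -> : series (fun k => pois l k * (al + be * k%:R + ga * (k%:R - l) ^+ 2)) =
    (fun n => (al + ga * l ^+ 2) * series (pois l) n
      + (be - 2 * ga * l) * series (fun k => pois l k * k%:R) n
      + ga * series (fun k => pois l k * k%:R ^+ 2) n).
  apply/funext => n; rewrite /series/= !mulr_sumr -!big_split/=.
  by apply: eq_bigr => k _; ring.
have -> : al + be * l + ga * l = (al + ga * l ^+ 2) * 1 + (be - 2 * ga * l) * l
  + ga * (l ^+ 2 + l) by ring.
apply: cvgD; [apply: cvgD|]; (apply: cvgM; first exact: cvg_cst).
- exact: cvg_series_pois.
- exact: cvg_series_pois_mean.
- exact: cvg_series_pois_sqr.
Qed.

Lemma is_cvg_series_pois_bounded l u (M : R) : 0 <= l -> (forall k, `|u k| <= M) ->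
  cvgn (series (fun k => pois l k * u k)).
Proof.
move=> l0 uM; apply: normed_cvg.
apply: (@series_le_cvg _ _ (fun k => M * pois l k)).
- by move=> k; exact: normr_ge0.
- by move=> k; rewrite mulr_ge0 ?pois_ge0// (le_trans _ (uM k)).
- by move=> k; rewrite /= normrM (ger0_norm (pois_ge0 _ _))// mulrC ler_wpM2r// pois_ge0.
- have -> : series (fun k => M * pois l k) = (fun n => M * series (pois l) n).
    by apply/funext => n; rewrite /series/= mulr_sumr.
  apply/cvg_ex; exists (M * 1); apply: cvgM; first exact: cvg_cst.
  exact: cvg_series_pois.
Qed.

Lemma ler_norm_series_pois l u (M : R) n : 0 <= l -> (forall k, `|u k| <= M) ->
  `|series (fun k => pois l k * u k) n| <= M.
Proof.
move=> l0 uM; have M0 : 0 <= M by exact: le_trans (uM 0%N).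
apply: (@le_trans _ _ (M * series (pois l) n)).
  rewrite /series/= mulr_sumr; apply: (le_trans (ler_norm_sum _ _ _)).
  apply: ler_sum => k _.
  by rewrite normrM (ger0_norm (pois_ge0 _ _))// mulrC ler_wpM2r// pois_ge0.
rewrite -[leRHS]mulr1 ler_wpM2l//.
have nd : nondecreasing_seq (series (pois l)).
  by apply: nondecreasing_series => k _ _; exact: pois_ge0.
have := nondecreasing_cvgn_le nd (cvgP _ (@cvg_series_pois l)) n.
by rewrite (cvg_lim _ (@cvg_series_pois l)).
Qed.

Lemma pois_le1 l k : 0 <= l -> `|pois l k| <= 1.
Proof.
(* With [u] the indicator of [k], the partial sum up to [k.+1] is the single weight at [k]. *)
move=> l0; have := @ler_norm_series_pois l (fun i => (i == k)%:R) 1 k.+1 l0.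
rewrite /series/= big_nat_recr//= eqxx mulr1 big1_seq ?add0r.
  by apply => i; case: eqP; rewrite ?normr1 ?normr0.
move=> i; rewrite mem_index_iota => /andP[_ /andP[_ ik]].
by rewrite (ltn_eqF ik) mulr0.
Qed.

(* The linear term disappears because D (k - l) has Poisson mean zero. *)
Lemma pois_expectation_approx l u (F D al be ga x : R) : 0 <= l ->
  (forall k, `|u k - F - D * (k%:R - l)| <= al + be * k%:R + ga * (k%:R - l) ^+ 2) ->
  series (fun k => pois l k * u k) @ \oo --> x ->
  `|x - F| <= al + be * l + ga * l.
Proof.
move=> l0 ub ux.
have H : series (fun k => pois l k * (u k - F - D * (k%:R - l))) @ \oo --> x - F.
  have -> : series (fun k => pois l k * (u k - F - D * (k%:R - l))) =
    (fun n => series (fun k => pois l k * u k) n - (F - D * l) * series (pois l) n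
      - D * series (fun k => pois l k * k%:R) n).
    apply/funext => n; rewrite /series/= !mulr_sumr -!sumrB.
    by apply: eq_bigr => k _; ring.
  have -> : x - F = x - (F - D * l) * 1 - D * l by ring.
  apply: cvgB; [apply: cvgB => //|]; (apply: cvgM; first exact: cvg_cst).
  - exact: cvg_series_pois.
  - exact: cvg_series_pois_mean.
have c2 : `|series (fun k => pois l k * (u k - F - D * (k%:R - l))) n| @[n --> \oo] --> `|x - F|
  by apply: cvg_norm.
rewrite -(cvg_lim _ c2)//; have c1 := @cvg_series_pois_quad l al be ga.
rewrite -(cvg_lim _ c1)//; apply: ler_lim; [exact: cvgP c2|exact: cvgP c1|].
apply: nearW => n /=.
rewrite /series/=; apply: (le_trans (ler_norm_sum _ _ _)); apply: ler_sum => k _.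
by rewrite normrM (ger0_norm (pois_ge0 _ _))// ler_wpM2l// pois_ge0.
Qed.

End PoissonMoments.

(** * Expectations, equality in law and independence of two variables *)

Section Expectation.
Context {d} {T : measurableType d} {R : realType} (P : probability T R).
Implicit Types Y Z : T -> R.

Lemma Rintegral_cst_probability (c : R) : \int[P]_w c = c.
Proof.
rewrite Rintegral_cst// -[RHS]mulr1; congr (_ * _).
exact: (congr1 fine (probability_setT P)).
Qed.

Lemma integrableZl_EFin (c : R) Y : P.-integrable setT (EFin \o Y) ->
  P.-integrable setT (EFin \o (fun w => c * Y w)).
Proof. exact: integrableZl. Qed.

Lemma integrableD_EFin Y Z : P.-integrable setT (EFin \o Y) ->
  P.-integrable setT (EFin \o Z) -> P.-integrable setT (EFin \o (fun w => Y w + Z w)).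
Proof. exact: integrableD. Qed.

Lemma integrable_bounded Y (M : R) : measurable_fun setT Y ->
  (forall w, `|Y w| <= M) -> P.-integrable setT (EFin \o Y).
Proof.
move=> mY YM; have := finite_measure_integrable_cst P M measurableT.
apply: le_integrable => //.
- exact/measurable_EFinP.
- by move=> w _; rewrite /= lee_fin (le_trans (YM w))// ler_norm.
Qed.

Lemma Rintegral_sum (h : nat -> T -> R) n :
  (forall k, P.-integrable setT (EFin \o h k)) ->
  \int[P]_w (\sum_(0 <= k < n) h k w) = \sum_(0 <= k < n) \int[P]_w h k w.
Proof.
move=> ih; rewrite /Rintegral; under eq_integral do rewrite -sumEFin.
rewrite integral_sum//.
rewrite sum_fine// => k _; apply: integrable_fin_num => //; exact: ih.
Qed.

(** Measurability of the limit is returned as well, because it serves for quantities reached only as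
    limits, such as a sum with random index or a Poisson mixture at a random parameter. *)
Lemma bounded_convergence (Y_ : nat -> T -> R) Y (M : R) :
  (forall n, measurable_fun setT (Y_ n)) -> (forall n w, `|Y_ n w| <= M) ->
  (forall w, Y_ ^~ w @ \oo --> Y w) ->
  measurable_fun setT Y /\
  \int[P]_w Y_ n w @[n --> \oo] --> \int[P]_w Y w.
Proof.
move=> mY_ YM Ycvg; have mY : measurable_fun setT Y.
  by apply: (measurable_fun_cvg mY_) => w _; exact: Ycvg.
have [iY _ H] : [/\ P.-integrable setT (EFin \o Y),
    [sequence \int[P]_w `|(EFin \o Y_ n) w - (EFin \o Y) w|]_n @ \oo --> 0 &
    [sequence \int[P]_w (EFin \o Y_ n) w]_n @ \oo --> \int[P]_w (EFin \o Y) w]%E.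
  apply: (@dominated_convergence _ _ _ _ _ _ _ _ (EFin \o cst M)) => //.
  - by move=> n; exact/measurable_EFinP.
  - exact/measurable_EFinP.
  - by apply: aeW => w _; apply: cvg_EFin; [exact: nearW|exact: Ycvg].
  - exact: finite_measure_integrable_cst.
  - by apply: aeW => w n _; rewrite /= lee_fin.
split=> //; apply: fine_cvg; rewrite fineK//; exact: integrable_fin_num.
Qed.

Lemma ge0_integral_eq_distr Y Z (phi : R -> \bar R) :
  measurable_fun setT Y -> measurable_fun setT Z ->
  (forall B, measurable B -> P (Y @^-1` B) = P (Z @^-1` B)) ->
  measurable_fun setT phi -> (forall x, 0 <= phi x)%E ->
  (\int[P]_w phi (Y w) = \int[P]_w phi (Z w))%E.
Proof.
move=> mY mZ YZ mphi phi0.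
rewrite -[LHS](@ge0_integral_pushforward _ _ _ _ R Y mY P setT phi)//.
rewrite -[RHS](@ge0_integral_pushforward _ _ _ _ R Z mZ P setT phi)//.
by apply: eq_measure_integral => B mB _; exact: YZ.
Qed.

Lemma integrable_eq_distr Y Z (phi : R -> R) :
  measurable_fun setT Y -> measurable_fun setT Z ->
  (forall B, measurable B -> P (Y @^-1` B) = P (Z @^-1` B)) ->
  measurable_fun setT phi ->
  P.-integrable setT (fun w => (phi (Z w))%:E) ->
  P.-integrable setT (fun w => (phi (Y w))%:E).
Proof.
move=> mY mZ YZ mphi /integrableP[_ iZ]; apply/integrableP; split.
  by apply/measurable_EFinP; exact: measurableT_comp.
rewrite (ge0_integral_eq_distr (phi := fun x => `|(phi x)%:E|%E) mY mZ YZ)//.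
by apply: measurableT_comp => //; exact/measurable_EFinP.
Qed.

Lemma integral_eq_distr Y Z (phi : R -> R) :
  measurable_fun setT Y -> measurable_fun setT Z ->
  (forall B, measurable B -> P (Y @^-1` B) = P (Z @^-1` B)) ->
  measurable_fun setT phi ->
  P.-integrable setT (fun w => (phi (Z w))%:E) ->
  (\int[P]_w (phi (Y w))%:E = \int[P]_w (phi (Z w))%:E)%E.
Proof.
move=> mY mZ YZ mphi iZ.
have iY := integrable_eq_distr mY mZ YZ mphi iZ.
have mphi' : measurable_fun setT (EFin \o phi) by exact/measurable_EFinP.
rewrite -[LHS](@integral_pushforward _ _ _ _ R Y mY P setT (EFin \o phi))//.
rewrite -[RHS](@integral_pushforward _ _ _ _ R Z mZ P setT (EFin \o phi))//.
by apply: eq_measure_integral => B mB _; exact: YZ.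
Qed.

Definition indep2 Y Z := forall A B : set R, measurable A -> measurable B ->
  P (Y @^-1` A `&` Z @^-1` B) = (P (Y @^-1` A) * P (Z @^-1` B))%E.

Lemma indep2_comp Y Z (f g : R -> R) : indep2 Y Z ->
  measurable_fun setT f -> measurable_fun setT g -> indep2 (f \o Y) (g \o Z).
Proof.
move=> YZ mf mg A B mA mB; apply: (YZ (f @^-1` A) (g @^-1` B)).
  by rewrite -[X in measurable X]setTI; exact: mf.
by rewrite -[X in measurable X]setTI; exact: mg.
Qed.

Section product.
Variables (Y Z : T -> R).
Hypotheses (mY : measurable_fun setT Y) (mZ : measurable_fun setT Z).
Hypothesis YZ : indep2 Y Z.

Let Y' : {RV P >-> R} := mfun_Sub (mem_set mY).
Let Z' : {RV P >-> R} := mfun_Sub (mem_set mZ).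
Let mYZ : measurable_fun setT (fun w => (Y w, Z w)).
Proof. exact/measurable_fun_pairP. Qed.
Let YZ' : {RV P >-> (R * R)%type} := mfun_Sub (mem_set mYZ).

(** Independence is equality on rectangles, and rectangles determine a product measure. Integrals
    over the joint law can thus be iterated. *)
Let joint_distribution (A : set (R * R)) : measurable A ->
  (distribution P Y' \x distribution P Z')%E A = distribution P YZ' A.
Proof.
by move=> mA; apply: product_measure_unique => // B C mB mC; exact: YZ.
Qed.

Let mprod : measurable_fun setT (fun z : R * R => z.1 * z.2).
Proof. exact: measurable_funM. Qed.

(** Tonelli on the joint law splits the mean of |YZ| into a product of two finite means. This is the
    integrability that Fubini requires in the next lemma. *)
Lemma integrable_indepM :
  P.-integrable setT (EFin \o Y) -> P.-integrable setT (EFin \o Z) ->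
  P.-integrable setT (fun w => (Y w * Z w)%:E).
Proof.
move=> /integrableP[_ iY] /integrableP[_ iZ]; apply/integrableP; split.
  by apply/measurable_EFinP; exact: measurable_funM.
have mn : measurable_fun setT (fun z : R * R => `|(z.1 * z.2)%:E|%E).
  by apply: measurableT_comp => //; exact/measurable_EFinP.
have mid : measurable_fun setT (fun y : R => `|y%:E|%E).
  by apply: measurableT_comp => //; exact/measurable_EFinP.
rewrite -(@ge0_integral_distribution _ _ _ _ _ P YZ' (fun z => `|(z.1 * z.2)%:E|%E))//.
rewrite (eq_measure_integral (distribution P Y' \x distribution P Z')%E); last first.
  by move=> A mA _; apply/esym; exact: joint_distribution.
rewrite fubini_tonelli1//=.
have E x : fubini_F (distribution P Z') (fun z : R * R => `|(z.1 * z.2)%:E|%E) x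
   = (`|x|%:E * \int[P]_w `|(Z w)%:E|)%E.
  rewrite /fubini_F/=; under eq_integral do rewrite normrM EFinM.
  rewrite ge0_integralZl//.
  congr (_ * _)%E.
  by rewrite (@ge0_integral_distribution _ _ _ _ _ P Z' (fun y => `|y|%:E)).
under eq_integral do rewrite E.
rewrite ge0_integralZr//; last exact: integral_ge0.
rewrite (@ge0_integral_distribution _ _ _ _ _ P Y' (fun y => `|y|%:E))//.
have ge0 : (0 <= \int[P]_x ((fun y : R => `|y|%:E) \o Y') x)%E.
  by apply: integral_ge0 => w _; rewrite lee_fin normr_ge0.
by apply: lte_mul_pinfty => //; rewrite ge0_fin_numE.
Qed.

Lemma Rintegral_indepM :
  P.-integrable setT (EFin \o Y) -> P.-integrable setT (EFin \o Z) ->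
  \int[P]_w (Y w * Z w) = \int[P]_w Y w * \int[P]_w Z w.
Proof.
move=> iY iZ; have iYZ := integrable_indepM iY iZ.
have mid : measurable_fun setT (fun y : R => y%:E) by exact/measurable_EFinP.
have mp : measurable_fun setT (fun z : R * R => (z.1 * z.2)%:E) by exact/measurable_EFinP.
have jE (h : R * R -> \bar R) : (\int[distribution P Y' \x distribution P Z']_z h z
   = \int[distribution P YZ']_z h z)%E.
  by apply: eq_measure_integral => A mA _; exact: joint_distribution.
rewrite /Rintegral -fineM ?integrable_fin_num//; congr fine.
rewrite -(@integral_distribution _ _ _ _ _ P YZ' (fun z => (z.1 * z.2)%:E))//.
rewrite -jE -integral12_prod_meas1/=; last first.
  apply/integrableP; split => //; rewrite jE ge0_integral_distribution//.
    by case/integrableP : iYZ.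
  exact: measurableT_comp.
have iZ' : (distribution P Z').-integrable setT (fun y => y%:E).
  exact: integrable_pushforward.
have iY' : (distribution P Y').-integrable setT (fun y => y%:E).
  exact: integrable_pushforward.
have E x : fubini_F (distribution P Z') (fun z : R * R => (z.1 * z.2)%:E) x
   = (x%:E * (\int[P]_w Z w)%:E)%E.
  rewrite /fubini_F/=; under eq_integral do rewrite EFinM.
  rewrite integralZl// (@integral_distribution _ _ _ _ _ P Z' (fun y => y%:E))//.
  by rewrite /Rintegral fineK// integrable_fin_num.
under eq_integral do rewrite E.
rewrite integralZr//.
rewrite (@integral_distribution _ _ _ _ _ P Y' (fun y => y%:E))//.
by rewrite /Rintegral fineK// integrable_fin_num.
Qed.

End product.

End Expectation.

(** * First and second moments of sums of i.i.d. variables *)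

Section IidMoments.
Context {d} {T : measurableType d} {R : realType} (P : probability T R).
Variables (X : nat -> T -> R) (a sigma2 : R).
Hypothesis iidX : iid P X.
Hypothesis iX : P.-integrable setT (fun w => (X 0%N w)%:E).
Hypothesis EX : (\int[P]_w (X 0%N w)%:E = a%:E)%E.
Hypothesis VX : (\int[P]_w ((X 0%N w - a) ^+ 2)%:E = sigma2%:E)%E.

Lemma iid_measurable j : measurable_fun setT (X j).
Proof. by case: iidX. Qed.
Let mX := iid_measurable.

Lemma iid_distr j (B : set R) : measurable B -> P (X j @^-1` B) = P (X 0%N @^-1` B).
Proof. by case: iidX => _ [_]; apply. Qed.

(** Independence of a long enough initial family is applied with the whole space at every index
    other than [i] and [j], where the factors are 1. *)
Lemma iid_indep2 i j : i != j -> indep2 P (X i) (X j).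
Proof.
move=> ij A B mA mB; set n := (maxn i j).+1.
have iN : (i < n)%N by rewrite ltnS leq_maxl.
have jN : (j < n)%N by rewrite ltnS leq_maxr.
pose i' := Ordinal iN; pose j' := Ordinal jN.
pose C (k : 'I_n) := if k == i' then A else if k == j' then B else setT.
have mC k : measurable (C k) by rewrite /C; case: ifP => // _; case: ifP.
have ji' : (j' == i') = false by apply/negbTE; rewrite eq_sym -val_eqE.
case: iidX => _ [/(_ n C mC) + _].
have -> : \bigcap_(k in [set: 'I_n]) (X k @^-1` C k) = X i @^-1` A `&` X j @^-1` B.
  apply/seteqP; split => w.
    move=> H; split; first by have := H i' I; rewrite /C eqxx.
    by have := H j' I; rewrite /C ji' eqxx.
  move=> [wA wB] k _; rewrite /C /preimage/=.
  case: eqP => [->//|_]; case: eqP => [->//|_] //.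
move=> ->; rewrite (bigD1 i')//= (bigD1 j') ?ji'//= big1 ?mulr1; last first.
  move=> k /andP[/negbTE ki /negbTE kj]; rewrite /C ki kj preimage_setT.
  by rewrite probability_setT.
rewrite /C eqxx ji' eqxx EFinM !fineK//; apply: fin_num_measure.
  by rewrite -[X in measurable X]setTI; exact: mX.
by rewrite -[X in measurable X]setTI; exact: mX.
Qed.

Let Y j w := X j w - a.
Let msub : measurable_fun setT (fun x : R => x - a).
Proof. exact: measurable_funB. Qed.
Let mY j : measurable_fun setT (Y j).
Proof. exact: measurable_funB. Qed.

Let iY j : P.-integrable setT (EFin \o Y j).
Proof.
apply: (integrable_eq_distr (phi := fun x => x - a) (Z := X 0%N)) => //.
  exact: iid_distr.
rewrite (_ : (fun w => (X 0%N w - a)%:E) = (fun w => (X 0%N w)%:E - (EFin \o cst a) w)%E)//.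
by apply: integrableB => //; exact: finite_measure_integrable_cst.
Qed.

Let EY j : \int[P]_w Y j w = 0.
Proof.
rewrite /Rintegral/= (integral_eq_distr (phi := fun x => x - a) (Z := X 0%N))//; last 2 first.
- exact: iid_distr.
- exact: (iY 0).
rewrite -[LHS]/(\int[P]_w (X 0%N w - cst a w)) RintegralB//; last first.
  exact: finite_measure_integrable_cst.
rewrite Rintegral_cst_probability.
by rewrite /Rintegral EX/= subrr.
Qed.

Let msqr : measurable_fun setT (fun x : R => (x - a) ^+ 2).
Proof. by apply: measurable_funX. Qed.

Let EYY j : (\int[P]_w (Y j w ^+ 2)%:E = sigma2%:E)%E.
Proof.
rewrite -VX (ge0_integral_eq_distr (Y := X j) (Z := X 0%N) (phi := fun x => ((x - a) ^+ 2)%:E))//.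
- exact: iid_distr.
- exact/measurable_EFinP.
- by move=> x; rewrite lee_fin sqr_ge0.
Qed.

Let iYY j : P.-integrable setT (fun w => (Y j w ^+ 2)%:E).
Proof.
apply/integrableP; split.
  by apply/measurable_EFinP; exact: measurable_funX.
under eq_integral do rewrite /= ger0_norm ?sqr_ge0//.
by rewrite EYY ltry.
Qed.

Lemma iid_variance_ge0 : 0 <= sigma2.
Proof.
by rewrite -lee_fin -VX; apply: integral_ge0 => w _; rewrite lee_fin sqr_ge0.
Qed.

Let sumE k w : \sum_(j < k) X j w - k%:R * a = \sum_(j < k) Y j w.
Proof. by rewrite sumrB sumr_const card_ord mulr_natl. Qed.

Let iS k : P.-integrable setT (fun w => (\sum_(j < k) Y j w)%:E).
Proof.
rewrite (_ : (fun _ => _) = (fun w => \sum_(j < k) (Y j w)%:E)%E); last first.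
  by apply/funext => w; rewrite sumEFin.
by apply: integrable_sum => // j _; exact: iY.
Qed.

Let ES k : \int[P]_w (\sum_(j < k) Y j w) = 0.
Proof.
elim: k => [|k IH].
  by rewrite (eq_Rintegral _ (g := cst 0)) ?Rintegral_cst_probability// => w _; rewrite big_ord0.
rewrite (eq_Rintegral _ (g := fun w => \sum_(j < k) Y j w + Y k w)); last first.
  by move=> w _; rewrite big_ord_recr.
by rewrite RintegralD ?IH ?EY ?addr0//; exact: iS.
Qed.

Let iYYm i j : i != j -> P.-integrable setT (fun w => (Y i w * Y j w)%:E).
Proof.
move=> ij; apply: integrable_indepM => //.
exact: indep2_comp (iid_indep2 ij) msub msub.
Qed.

Let EYYm i j : i != j -> \int[P]_w (Y i w * Y j w) = 0.
Proof.
move=> ij; rewrite Rintegral_indepM ?EY ?mul0r//.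
exact: indep2_comp (iid_indep2 ij) msub msub.
Qed.

Let iSYm k n : (k <= n)%N -> P.-integrable setT (fun w => ((\sum_(j < k) Y j w) * Y n w)%:E).
Proof.
move=> kn.
rewrite (_ : (fun _ => _) = (fun w => \sum_(j < k) (Y j w * Y n w)%:E)%E); last first.
  by apply/funext => w; rewrite sumEFin mulr_suml.
apply: integrable_sum => // j _; apply: iYYm.
by rewrite neq_ltn (leq_trans (ltn_ord j)).
Qed.

(** The product is expanded into pairs [Y j * Y n] with j < n, each of mean zero by pairwise
    independence. This is the cross term in the additivity of variances. *)
Let ESYm k n : (k <= n)%N -> \int[P]_w ((\sum_(j < k) Y j w) * Y n w) = 0.
Proof.
elim: k => [|k IH] kn.
  by rewrite (eq_Rintegral _ (g := cst 0)) ?Rintegral_cst_probability// => w _; rewrite big_ord0 mul0r.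
rewrite (eq_Rintegral _ (g := fun w => (\sum_(j < k) Y j w) * Y n w + Y k w * Y n w)); last first.
  by move=> w _; rewrite big_ord_recr/= mulrDl.
have kn' : k != n by rewrite neq_ltn kn.
rewrite RintegralD//; [|exact: iSYm (ltnW kn)|exact: iYYm].
by rewrite IH ?(ltnW kn)// EYYm// addr0.
Qed.

Let ESS k : P.-integrable setT (fun w => ((\sum_(j < k) Y j w) ^+ 2)%:E) /\
  \int[P]_w ((\sum_(j < k) Y j w) ^+ 2) = k%:R * sigma2.
Proof.
elim: k => [|k [ik IH]].
  have E : (fun w => (\sum_(j < 0) Y j w) ^+ 2) = cst 0.
    by apply/funext => w; rewrite big_ord0 expr0n.
  split; last by rewrite (_ : (fun w => _) = cst 0)// Rintegral_cst_probability ?mul0r.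
  rewrite (_ : (fun _ => _) = EFin \o cst 0); first exact: finite_measure_integrable_cst.
  by rewrite -E.
have E w : (\sum_(j < k.+1) Y j w) ^+ 2 =
   (\sum_(j < k) Y j w) ^+ 2 + (2 * ((\sum_(j < k) Y j w) * Y k w) + Y k w ^+ 2).
  by rewrite big_ord_recr/=; ring.
have i2 : P.-integrable setT (EFin \o (fun w => 2 * ((\sum_(j < k) Y j w) * Y k w))).
  by apply: integrableZl_EFin; exact: iSYm.
have i3 : P.-integrable setT (EFin \o (fun w => 2 * ((\sum_(j < k) Y j w) * Y k w) + Y k w ^+ 2)).
  by apply: integrableD_EFin => //; exact: iYY.
split.
  rewrite (_ : (fun _ => _) = (fun w => ((\sum_(j < k) Y j w) ^+ 2)%:E +
    (EFin \o (fun w => 2 * ((\sum_(j < k) Y j w) * Y k w) + Y k w ^+ 2)%R) w)%E); last first.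
    by apply/funext => w; rewrite E EFinD.
  exact: integrableD_EFin.
under eq_Rintegral do rewrite E.
rewrite RintegralD// IH RintegralD//; last exact: iYY.
rewrite RintegralZl//; last exact: iSYm.
rewrite ESYm// mulr0 add0r {1}/Rintegral EYY/= -natr1 mulrDl mul1r//.
Qed.

Lemma iid_sum_integral_affine k (c y : R) :
  P.-integrable setT (fun w => (c * \sum_(j < k) X j w - y)%:E) /\
  \int[P]_w (c * \sum_(j < k) X j w - y) = c * (k%:R * a) - y.
Proof.
have E w : c * \sum_(j < k) X j w - y =
    c * \sum_(j < k) Y j w + cst (c * (k%:R * a) - y) w.
  by rewrite -sumE /=; ring.
have i1 : P.-integrable setT (EFin \o (fun w => c * \sum_(j < k) Y j w)).
  by apply: integrableZl_EFin; exact: iS.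
split.
  rewrite (_ : (fun _ => _) = (fun w => (EFin \o (fun w => c * \sum_(j < k) Y j w)%R) w
     + (EFin \o cst (c * (k%:R * a) - y)%R) w)%E); last first.
    by apply/funext => w; rewrite E EFinD.
  by apply: integrableD_EFin => //; exact: finite_measure_integrable_cst.
under eq_Rintegral do rewrite E.
rewrite RintegralD//; last exact: finite_measure_integrable_cst.
rewrite RintegralZl//; last exact: iS.
by rewrite ES mulr0 add0r Rintegral_cst_probability.
Qed.

(** Decomposition into variance and squared bias [b ^+ 2]: after centring, the term linear in the
    sum has mean zero. It is used with [c = (a * m)^-1] and [y = x / m]. *)
Lemma iid_sum_integral_sqr k (c y : R) :
  P.-integrable setT (fun w => ((c * \sum_(j < k) X j w - y) ^+ 2)%:E) /\
  \int[P]_w ((c * \sum_(j < k) X j w - y) ^+ 2) =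
    c ^+ 2 * (k%:R * sigma2) + (c * (k%:R * a) - y) ^+ 2.
Proof.
pose b := c * (k%:R * a) - y.
have [i2 E2] := ESS k.
have E w : (c * \sum_(j < k) X j w - y) ^+ 2 =
    c ^+ 2 * (\sum_(j < k) Y j w) ^+ 2 + (2 * b * c * \sum_(j < k) Y j w + cst (b ^+ 2) w).
  by rewrite -sumE /= /b; ring.
have j1 : P.-integrable setT (EFin \o (fun w => c ^+ 2 * (\sum_(j < k) Y j w) ^+ 2)).
  by apply: integrableZl_EFin.
have j2 : P.-integrable setT (EFin \o (fun w => 2 * b * c * \sum_(j < k) Y j w)).
  by apply: integrableZl_EFin; exact: iS.
have j3 : P.-integrable setT (EFin \o (fun w => 2 * b * c * \sum_(j < k) Y j w + cst (b ^+ 2) w)).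
  by apply: integrableD_EFin => //; exact: finite_measure_integrable_cst.
split.
  rewrite (_ : (fun _ => _) = (fun w => (EFin \o (fun w => c ^+ 2 * (\sum_(j < k) Y j w) ^+ 2)%R) w
     + (EFin \o (fun w => 2 * b * c * \sum_(j < k) Y j w + cst (b ^+ 2) w)%R) w)%E); last first.
    by apply/funext => w; rewrite E EFinD.
  exact: integrableD_EFin.
under eq_Rintegral do rewrite E.
rewrite RintegralD// RintegralD//; last exact: finite_measure_integrable_cst.
rewrite RintegralZl; [|by []|exact: i2].
rewrite RintegralZl; [|by []|exact: iS].
by rewrite ES mulr0 add0r E2 Rintegral_cst_probability.
Qed.

End IidMoments.

(** * The law of a Poisson process at an independent random time *)

Section MixedPoisson.
Context {d} {T : measurableType d} {R : realType} (P : probability T R).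

(** Serves for a process evaluated at a random time with countably many values: each piece fixes the
    time, and the preimage is a countable union. *)
Lemma measurable_fun_piecewise (F : nat -> set T) (g : nat -> T -> R) (h : T -> R) :
  (forall i, measurable (F i)) -> \bigcup_i F i = setT ->
  (forall i, measurable_fun setT (g i)) ->
  (forall i w, F i w -> h w = g i w) -> measurable_fun setT h.
Proof.
move=> mF covF mg hg _ B mB; rewrite setTI.
rewrite (_ : h @^-1` B = \bigcup_i (F i `&` g i @^-1` B)).
  apply: bigcup_measurable => i _; apply: measurableI => //.
  by rewrite -[X in measurable X]setTI; exact: mg.
apply/seteqP; split => w.
  move=> Bh; have : [set: T] w by []; rewrite -covF => -[i _ Fiw].
  by exists i => //; split => //; rewrite /preimage/= -(hg i).
by move=> [i _ [Fiw Bg]]; rewrite /preimage/= (hg i).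
Qed.

(** For [0 <= x], the least multiple of 1/(k+1) strictly above [x]. The approximation is from the
    right to suit the right continuity of the paths of [N]. *)
Definition grid (k : nat) (x : R) : R := (Num.truncn (x * k.+1%:R)).+1%:R / k.+1%:R.

Lemma grid_gt k x : x < grid k x.
Proof. by rewrite ltr_pdivlMr// truncnS_gt. Qed.

Lemma grid_le k x : 0 <= x -> grid k x <= x + k.+1%:R^-1.
Proof.
move=> x0; rewrite ler_pdivrMr// mulrDl mulVf// -natr1 lerD2r.
by rewrite truncn_le mulr_ge0.
Qed.

Lemma cvg_grid x : 0 <= x -> grid k x @[k --> \oo] --> x.
Proof.
move=> x0; apply: (@squeeze_cvgr _ _ _ _ (cst x) (fun k => x + k.+1%:R^-1)).
- by apply: nearW => k; rewrite /= ltW ?grid_gt//= grid_le.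
- exact: cvg_cst.
- rewrite -[X in _ --> X]addr0; apply: cvgD; first exact: cvg_cst.
  exact: cvg_harmonic.
Qed.

Lemma continuous_pois j : continuous (fun l : R => pois l j).
Proof.
move=> l; apply: cvgM; last exact: cvg_cst.
by apply: cvgM; [exact: continuous_expRN|exact: exprn_continuous].
Qed.

Variables (N : R -> T -> nat) (l : T -> R).
Hypothesis poisN : poisson_process P N.
Hypothesis ml : measurable_fun setT l.
Hypothesis l0 : forall w, 0 < l w.
Hypothesis Nl : forall t, 0 <= t -> indep2 P (fun w => (N t w)%:R) l.

Let mNt (t : R) : measurable_fun setT (fun w => (N t w)%:R : R).
Proof. by case: poisN. Qed.

Let natset (t : R) j : (fun w => (N t w)%:R : R) @^-1` [set j%:R] = [set w | N t w = j].
Proof.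
apply/seteqP; split => w; rewrite /preimage/=; last by move=> ->.
by move=> /eqP; rewrite eqr_nat => /eqP.
Qed.

Lemma poisson_process_law (t : R) j : 0 <= t -> P [set w | N t w = j] = (pois t j)%:E.
Proof.
move=> t0; case: poisN => _ [N0 [_ [_ [/(_ 0 t j (lexx _) t0) + _]]]].
rewrite subr0 => <-; congr (P _); apply/seteqP; split => w /=; by rewrite N0 subn0.
Qed.

Let F k i := l @^-1` `[i%:R / k.+1%:R, i.+1%:R / k.+1%:R[%classic.

Let mF k i : measurable (F k i).
Proof. by rewrite -[X in measurable X]setTI; exact: ml. Qed.

Let F_trunc k i w : F k i w <-> Num.truncn (l w * k.+1%:R) = i.
Proof.
rewrite /F /preimage/= in_itv/= ler_pdivrMr// ltr_pdivlMr//.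
split; first exact: truncn_def.
by move=> <-; apply: truncn_itv; rewrite mulr_ge0// ltW.
Qed.

Let covF k : \bigcup_i F k i = setT.
Proof. by apply/seteqP; split => // w _; eexists => //; apply/F_trunc. Qed.

Let trivF k : trivIset setT (F k).
Proof.
apply/trivIsetP => i j _ _ /eqP ij; apply/seteqP; split => // w.
by move=> [/F_trunc wi /F_trunc wj]; apply: ij; rewrite -wi.
Qed.

Let gridF k i w : F k i w -> grid k (l w) = i.+1%:R / k.+1%:R.
Proof. by move/F_trunc; rewrite /grid => ->. Qed.

Let mN_grid k : measurable_fun setT (fun w => (N (grid k (l w)) w)%:R : R).
Proof.
apply: (measurable_fun_piecewise (F := F k) (g := fun i w => (N (i.+1%:R / k.+1%:R) w)%:R)) => //.
by move=> i w /gridF ->.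
Qed.

Let mpois_grid k j : measurable_fun setT (fun w => pois (grid k (l w)) j).
Proof.
apply: (measurable_fun_piecewise (F := F k) (g := fun i _ => pois (i.+1%:R / k.+1%:R) j)) => //.
by move=> i w /gridF ->.
Qed.

(** Integer-valued right continuity makes the path constant just after [l w], so the approximation
    is eventually exact, with a rank depending on [w]. *)
Let N_grid_near w : \forall k \near \oo, N (grid k (l w)) w = N (l w) w.
Proof.
case: poisN => _ [_ [_ [/(_ w (l w) (ltW (l0 w))) [e e0 H] _]]].
have := cvg_grid (ltW (l0 w)) => /cvgrPdist_lt /(_ e e0).
apply: filterS => k /= Hk; rewrite H//; first exact/ltW/grid_gt.
rewrite -ltrBlDl; apply: le_lt_trans Hk.
by rewrite distrC ler_norm.
Qed.

Lemma measurable_poisson_at : measurable_fun setT (fun w => (N (l w) w)%:R : R).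
Proof.
apply: (measurable_fun_cvg mN_grid) => w _; apply: cvg_near_cst.
by apply: filterS (N_grid_near w) => k ->.
Qed.

Let phi j (x : R) : R := \1_[set j%:R] x.

Let mphi j : measurable_fun setT (phi j).
Proof. exact: measurable_indic. Qed.

(** On the cell [F k i] the grid time is a constant [t]. The event N t = j is independent of the
    cell, so each cell contributes [pois t j] times its probability. *)
Let N_grid_law k j :
  (\int[P]_w (phi j (N (grid k (l w)) w)%:R)%:E = \int[P]_w (pois (grid k (l w)) j)%:E)%E.
Proof.
rewrite -(covF k) !ge0_integral_bigcup//; last 4 first.
- by apply: measurable_funTS; exact/measurable_EFinP.
- move=> w _; rewrite lee_fin pois_ge0// (le_trans (ltW (l0 w)))//.
  exact/ltW/grid_gt.
- by apply: measurable_funTS; apply/measurable_EFinP; exact: measurableT_comp.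
- by move=> w _; rewrite lee_fin.
apply: eq_eseriesr => i _; set t : R := i.+1%:R / k.+1%:R.
have t0 : 0 <= t by rewrite divr_ge0.
have mA : measurable [set w | N t w = j].
  by rewrite -natset -[X in measurable X]setTI; exact: mNt.
rewrite (eq_integral (fun w => (\1_[set w | N t w = j] w)%:E)); last first.
  move=> w /set_mem /gridF ->; rewrite /phi !indicE -/t; congr (_ %:R%:E).
  congr nat_of_bool; apply/idP/idP; rewrite !inE/=; last by move=> ->.
  by move=> /eqP; rewrite eqr_nat => /eqP.
rewrite integral_indic// -natset.
apply: (etrans (Nl t0 (measurable_set1 _) (measurable_itv _))).
rewrite natset poisson_process_law//.
rewrite -[RHS](_ : (\int[P]_(w in F k i) (pois t j)%:E = _)%E); last first.
  by apply: eq_integral => w /set_mem /gridF ->.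
by rewrite integral_cst.
Qed.

(* Right continuity lets N(l) be approximated by N at the grid points
   just above l, where the independence of N and l can be used. *)
Lemma mixed_poisson_law j :
  \int[P]_w (\1_[set j%:R] ((N (l w) w)%:R : R) : R) = \int[P]_w (pois (l w) j).
Proof.
have [_ c1] : measurable_fun setT (fun w => phi j (N (l w) w)%:R) /\
    \int[P]_w (phi j (N (grid k (l w)) w)%:R) @[k --> \oo] -->
    \int[P]_w (phi j (N (l w) w)%:R).
  apply: (@bounded_convergence _ _ _ P _ _ 1).
  - by move=> k; exact: measurableT_comp.
  - by move=> k w; rewrite /phi indicE; case: (_ \in _); rewrite ?normr1 ?normr0.
  - move=> w; apply: cvg_near_cst.
    by apply: filterS (N_grid_near w) => k ->.
have [_ c2] : measurable_fun setT (fun w => pois (l w) j) /\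
    \int[P]_w (pois (grid k (l w)) j) @[k --> \oo] --> \int[P]_w (pois (l w) j).
  apply: (@bounded_convergence _ _ _ P _ _ 1) => //.
  - move=> k w; apply: pois_le1; apply: (le_trans (ltW (l0 w))).
    exact/ltW/grid_gt.
  - move=> w; apply: (@cvg_comp _ _ _ _ (fun l => pois l j)); last exact: continuous_pois.
    exact/cvg_grid/ltW.
rewrite /phi in c1 *.
have E : (fun k => \int[P]_w (phi j (N (grid k (l w)) w)%:R)) =
         (fun k => \int[P]_w (pois (grid k (l w)) j)).
  by apply/funext => k; rewrite /Rintegral N_grid_law.
by move: c1; rewrite -/(phi j) E => c1; exact: (cvg_unique _ c1 c2).
Qed.

End MixedPoisson.

(** * Expectation of a function of a sum with mixed Poisson index *)

Section CompoundPoisson.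
Context {d} {T : measurableType d} {R : realType} (P : probability T R).

(** The generated sigma-algebra is taken as the measurable structure on [T]. Each [X j] is
    measurable for it by construction, hence so are their sums. *)
Lemma sigma_of_sum (X : nat -> T -> R) k (B : set R) : measurable B ->
  sigma_of setT X ((fun w => \sum_(j < k) X j w) @^-1` B).
Proof.
move=> mB; rewrite /sigma_of; set G := (G in <<s setT, G >>).
pose X' (j : nat) (w : g_sigma_algebraType G) : R := X j w.
have mX' j : measurable_fun setT (X' j).
  move=> _ C mC; rewrite setTI; apply: sub_sigma_algebra.
  by exists j; split => //; exists C.
have := @measurable_sum _ (g_sigma_algebraType G) R setT _ (index_enum 'I_k) (fun j => X' j)
   (fun j => mX' j).
by move=> /(_ measurableT B mB); rewrite setTI.
Qed.

Lemma sigma_of_gen (I : Type) (D : set I) (X : I -> T -> R) i (B : set R) :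
  D i -> measurable B -> sigma_of D X (X i @^-1` B).
Proof.
by move=> Di mB; apply: sub_sigma_algebra; exists i; split => //; exists B.
Qed.

(** Splitting according to the value n of the index, truncated at K: the truncation is 0 until K
    exceeds n and constant from then on. *)
Lemma sum_indic_nat (h : nat -> R) (n K : nat) :
  \sum_(0 <= k < K) \1_[set k%:R] (n%:R : R) * h k = if (n < K)%N then h n else 0.
Proof.
elim: K => [|K IH]; first by rewrite big_geq.
rewrite big_nat_recr//= IH indicE ltnS.
have -> : ((n%:R : R) \in [set K%:R]) = (n == K).
  apply/idP/idP; rewrite inE/=; last by move=> /eqP ->.
  by move=> /eqP; rewrite eqr_nat.
by case: ltngtP => [nK|nK|->]; rewrite ?mul0r ?addr0 ?mul1r ?add0r.
Qed.

Variables (N : R -> T -> nat) (l : T -> R) (X : nat -> T -> R).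
Hypothesis poisN : poisson_process P N.
Hypothesis ml : measurable_fun setT l.
Hypothesis l0 : forall w, 0 < l w.
Hypothesis Nl : forall t, 0 <= t -> indep2 P (fun w => (N t w)%:R) l.
Hypothesis iidX : iid P X.
Hypothesis NX : forall k, indep2 P (fun w => (N (l w) w)%:R) (fun w => \sum_(j < k) X j w).

Variables (f : R -> R) (M c : R).
Hypothesis cf : continuous f.
Hypothesis fM : forall x, `|f x| <= M.

Let mf : measurable_fun setT f := continuous_measurable_fun cf.

Let mX j : measurable_fun setT (X j).
Proof. exact: iid_measurable iidX j. Qed.

Let mS k : measurable_fun setT (fun w => \sum_(j < k) X j w).
Proof. exact: measurable_sum. Qed.

Let mfc : measurable_fun setT (fun x => f (c * x)).
Proof. by apply: measurableT_comp => //; exact: measurable_funM. Qed.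

Definition sum_expectation k := \int[P]_w f (c * \sum_(j < k) X j w).
Let g := sum_expectation.

Let mfS k : measurable_fun setT (fun w => f (c * \sum_(j < k) X j w)).
Proof. exact: (measurableT_comp mfc (mS k)). Qed.

Let g_le k : `|g k| <= M.
Proof.
apply: (le_trans (le_normr_Rintegral _ _)) => //.
  exact: integrable_bounded (mfS k) (fun w => fM _).
rewrite -(Rintegral_cst_probability P M); apply: le_Rintegral => //.
- apply: (@integrable_bounded _ _ _ _ _ M) => [|w]; last by rewrite normr_id.
  exact: measurableT_comp.
- exact: finite_measure_integrable_cst.
Qed.

(** The function H of the overview. [poisson_mixture_cvg] gives the limit its meaning for
    [0 <= x]. *)
Definition poisson_mixture (x : R) := limn (series (fun k => pois x k * g k)).

Lemma poisson_mixture_cvg x : 0 <= x ->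
  series (fun k => pois x k * g k) @ \oo --> poisson_mixture x.
Proof. by move=> x0; exact: is_cvg_series_pois_bounded x0 g_le. Qed.

Let indicN k w : R := \1_[set k%:R] ((N (l w) w)%:R : R).

Let mindicN k : measurable_fun setT (indicN k).
Proof.
apply: measurableT_comp (measurable_poisson_at poisN ml l0); exact: measurable_indic.
Qed.

Let indicN_le k w : `|indicN k w| <= 1.
Proof. by rewrite /indicN indicE; case: (_ \in _); rewrite ?normr1 ?normr0. Qed.

(** Independence is used twice: N(l) from the k-th partial sum, to factor the mean, and then N from
    [l], through the mixed Poisson law. The constant [g k] is finally put back under the
    integral. *)
Let EindicN k : \int[P]_w (indicN k w * f (c * \sum_(j < k) X j w)) =
  \int[P]_w (pois (l w) k * g k).
Proof.
have mpois : measurable_fun setT (fun w => pois (l w) k).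
  exact: measurableT_comp (continuous_measurable_fun (@continuous_pois _ k)) ml.
have pois1 w : `|pois (l w) k| <= 1 by rewrite pois_le1// ltW.
rewrite Rintegral_indepM//; last 3 first.
- exact: indep2_comp (NX k) (measurable_indic (measurable_set1 _)) mfc.
- exact: integrable_bounded (mindicN k) (indicN_le k).
- exact: integrable_bounded (mfS k) (fun w => fM _).
rewrite RintegralZr//; last exact: integrable_bounded mpois pois1.
by rewrite (mixed_poisson_law poisN ml l0 Nl).
Qed.

(** Both sides are truncated at K: the splitting by the value of N(l), and the Poisson series.
    [EindicN] equates the truncated means for every K, and since both truncations are bounded by
    [M], bounded convergence passes to the limit. *)
Lemma compound_poisson_expectation :
  [/\ measurable_fun setT (fun w => f (c * \sum_(j < N (l w) w) X j w)),
      measurable_fun setT (fun w => poisson_mixture (l w)),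
      (forall w, `|poisson_mixture (l w)| <= M) &
      \int[P]_w f (c * \sum_(j < N (l w) w) X j w) = \int[P]_w poisson_mixture (l w)].
Proof.
have M0 : 0 <= M by exact: le_trans (fM 0).
have mpois k : measurable_fun setT (fun w => pois (l w) k).
  exact: measurableT_comp (continuous_measurable_fun (@continuous_pois _ k)) ml.
pose G K w := \sum_(0 <= k < K) indicN k w * f (c * \sum_(j < k) X j w).
have GE K w : G K w = if (N (l w) w < K)%N then f (c * \sum_(j < N (l w) w) X j w) else 0.
  by rewrite /G /indicN (sum_indic_nat (fun k => f (c * \sum_(j < k) X j w))).
have [m1 c1] : measurable_fun setT (fun w => f (c * \sum_(j < N (l w) w) X j w)) /\
    \int[P]_w G K w @[K --> \oo] --> \int[P]_w f (c * \sum_(j < N (l w) w) X j w).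
  apply: (@bounded_convergence _ _ _ P _ _ M).
  - by move=> K; apply: measurable_sum => k; exact: measurable_funM.
  - by move=> K w; rewrite GE; case: ifP => // _; rewrite normr0.
  - move=> w; apply: cvg_near_cst; near=> K; rewrite GE ifT//.
    by near: K; exact: nbhs_infty_gt.
have [m2 c2] : measurable_fun setT (fun w => poisson_mixture (l w)) /\
    \int[P]_w (series (fun k => pois (l w) k * g k) K) @[K --> \oo] -->
    \int[P]_w poisson_mixture (l w).
  apply: (@bounded_convergence _ _ _ P _ _ M).
  - by move=> K; apply: measurable_sum => k; apply: measurable_funM.
  - by move=> K w; apply: ler_norm_series_pois => //; exact: ltW.
  - by move=> w; apply: poisson_mixture_cvg; exact: ltW.
split => //.
  move=> w; have H := poisson_mixture_cvg (ltW (l0 w)).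
  have H2 : `|series (fun k => pois (l w) k * g k) n| @[n --> \oo]
      --> `|poisson_mixture (l w)| by apply: cvg_norm.
  rewrite -(cvg_lim _ H2)//; apply: limr_le; first exact: cvgP H2.
  by apply: nearW => n; apply: ler_norm_series_pois => //; exact: ltW.
have E : (fun K => \int[P]_w G K w) =
    (fun K => \int[P]_w (series (fun k => pois (l w) k * g k) K)).
  apply/funext => K; rewrite /G /series/= !Rintegral_sum.
  - by apply: eq_bigr => k _; exact: EindicN.
  - move=> k; apply: (@integrable_bounded _ _ _ _ _ (1 * M)).
      exact: measurable_funM.
    move=> w; rewrite normrM; apply: ler_pM; [by []|by []| |exact: g_le].
    by rewrite pois_le1// ltW.
  - move=> k; apply: (@integrable_bounded _ _ _ _ _ (1 * M)).
      by apply: measurable_funM; [exact: mindicN|exact: mfS].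
    by move=> w; rewrite normrM; apply: ler_pM; [| |exact: indicN_le|exact: fM].
by move: c1; rewrite E => c1; exact: (cvg_unique _ c1 c2).
Unshelve. all: by end_near. Qed.

End CompoundPoisson.

(** * The bound for a single test function *)

Section TransferBound.
Context {d} {T : measurableType d} {R : realType} (P : probability T R).
Variables (N : R -> T -> nat) (l : T -> R) (X : nat -> T -> R) (a sigma2 m s : R).
Hypothesis poisN : poisson_process P N.
Hypothesis ml : measurable_fun setT l.
Hypothesis l0 : forall w, 0 < l w.
Hypothesis Nl : forall t, 0 <= t -> indep2 P (fun w => (N t w)%:R) l.
Hypothesis iidX : iid P X.
Hypothesis iX : P.-integrable setT (fun w => (X 0%N w)%:E).
Hypothesis EX : (\int[P]_w (X 0%N w)%:E = a%:E)%E.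
Hypothesis a0 : a != 0.
Hypothesis VX : (\int[P]_w ((X 0%N w - a) ^+ 2)%:E = sigma2%:E)%E.
Hypothesis NX : forall k, indep2 P (fun w => (N (l w) w)%:R) (fun w => \sum_(j < k) X j w).
Hypothesis m0 : 0 < m.
Hypothesis s12 : 1 <= s <= 2.
Variable f : R -> R.
Hypothesis zf : zol_class s f.

Let kappa := Gamma (1 + zol_alpha s) / Gamma (1 + s).
Let c := (a * m)^-1.
Let tau := 1 + sigma2 / a ^+ 2.

Let cf : continuous f := zol_class_continuous s12 zf.

Let sigma2_ge0 : 0 <= sigma2 := iid_variance_ge0 VX.

Let a2_gt0 : 0 < a ^+ 2.
Proof. by rewrite exprn_even_gt0. Qed.

Let tau_gt0 : 0 < tau.
Proof. by rewrite ltr_pwDl// divr_ge0// ltW. Qed.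

Lemma Gamma_ratio_ge0 : 0 <= kappa.
Proof.
have [/andP[s1 s2]] := (s12, tt).
rewrite divr_ge0// ltW// Gamma_gt0//; last by lra.
have [->|s1'] := eqVneq s 1; first by rewrite /zol_alpha zol_m1; lra.
have {}s1' : 1 < s by rewrite lt_neqAle eq_sym s1'.
by rewrite /zol_alpha zol_m_gt1 ?s1'//; lra.
Qed.

(** The Taylor bound is averaged over the X's for each fixed count k, then over the Poisson count.
    Here [v] is the variance of the compound sum divided by [a * m]: in [tau], the 1 comes from the
    randomness of the count and sigma2 / a^2 from that of the summands. *)
Lemma poisson_mixture_approx (x : R) : 0 < x ->
  `|poisson_mixture P X f c x - f (x / m)| <= kappa * (x * tau / m ^+ 2) `^ (s / 2).
Proof.
move=> x0; have [[M fM] _] := zf.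
have [D HD] := zol_class_taylor s12 zf (x / m).
set v := x * tau / m ^+ 2; set p := s / 2.
have v0 : 0 < v by rewrite divr_gt0 ?mulr_gt0// exprn_gt0.
set q := kappa * v `^ (p - 1).
have am0 : (m != 0) && (a != 0) by rewrite a0 gt_eqF.
(* Writes v^p = v^(p-1) (p v + (1-p) v) and splits [v] inside p v into its summand part and its
   count part, to match the coefficients [al], [be], [ga] of the quadratic Poisson bound. *)
have -> : kappa * v `^ p = q * (1 - p) * v + q * p * c ^+ 2 * sigma2 * x + q * p / m ^+ 2 * x.
  have -> : v `^ p = v `^ (p - 1) * v.
    rewrite -[X in _ * X](powRr1 (ltW v0)) -powRD ?subrK//.
    by apply/implyP => _; rewrite gt_eqF.
  by rewrite mulrA -/q /v /tau /c; field.
(* The slope becomes [D / m] because [c * a = m^-1]: the mean of [D] times the deviation from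
   [x / m] is D (k - x) / m. *)
apply: (@pois_expectation_approx R x (sum_expectation P X f c) (f (x / m)) (D / m)).
- exact: ltW.
- move=> k; rewrite /sum_expectation.
  have [i1 E1] := iid_sum_integral_affine iidX iX EX k c (x / m).
  have [i2 E2] := iid_sum_integral_sqr iidX iX EX VX k c (x / m).
  have mS : measurable_fun setT (fun w => \sum_(j < k) X j w).
    by apply: measurable_sum => j; exact: iid_measurable iidX j.
  have mfS : measurable_fun setT (fun w => f (c * \sum_(j < k) X j w)).
    apply: measurableT_comp; first exact: continuous_measurable_fun.
    exact: measurable_funM.
  have ifS : P.-integrable setT (EFin \o (fun w => f (c * \sum_(j < k) X j w))).
    exact: integrable_bounded mfS (fun w => fM _).
  pose r w := f (c * \sum_(j < k) X j w) + (- f (x / m)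
      + - D * (c * \sum_(j < k) X j w - x / m)).
  have icst b : P.-integrable setT (EFin \o (fun=> b)) by exact: finite_measure_integrable_cst.
  have iD : P.-integrable setT (EFin \o (fun w => - D * (c * \sum_(j < k) X j w - x / m))).
    exact: integrableZl_EFin.
  have iE : P.-integrable setT (EFin \o (fun w => - f (x / m)
      + - D * (c * \sum_(j < k) X j w - x / m))) by exact: integrableD_EFin.
  have ir : P.-integrable setT (EFin \o r) by exact: integrableD_EFin.
  have -> : \int[P]_w f (c * \sum_(j < k) X j w) - f (x / m) - D / m * (k%:R - x) =
     \int[P]_w r w.
    rewrite RintegralD// RintegralD// RintegralZl// E1 Rintegral_cst_probability.
    by rewrite /c; field.
  apply: (le_trans (le_normr_Rintegral _ ir)) => //.
  pose b w := q * p * (c * \sum_(j < k) X j w - x / m) ^+ 2 + q * (1 - p) * v.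
  have ib1 : P.-integrable setT (EFin \o (fun w => q * p * (c * \sum_(j < k) X j w - x / m) ^+ 2)).
    exact: integrableZl_EFin.
  have ib : P.-integrable setT (EFin \o b) by exact: integrableD_EFin.
  apply: (@le_trans _ _ (\int[P]_w b w)).
    apply: le_Rintegral => //; first exact: integrable_norm.
    move=> w _; have := HD (c * \sum_(j < k) X j w).
    rewrite (_ : _ - _ - _ = r w); last by rewrite /r; ring.
    move=> /le_trans; apply.
    have := powR_le_quadratic (c * \sum_(j < k) X j w - x / m) s12 v0.
    move=> /(ler_wpM2l Gamma_ratio_ge0) /le_trans; apply.
    by rewrite /b /q -/p le_eqVlt; apply/orP; left; apply/eqP; ring.
  rewrite RintegralD// RintegralZl// E2 Rintegral_cst_probability.
  by rewrite le_eqVlt; apply/orP; left; apply/eqP; rewrite /c; field.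
- by apply: (poisson_mixture_cvg iidX cf fM); exact: ltW.
Qed.

(** The moment of order s/2 of [l] may be infinite, so the pointwise bound at x = l w is integrated
    in the extended reals. *)
Lemma zol_class_transfer_bound :
  (`| \int[P]_w f (c * \sum_(j < N (l w) w) X j w) - \int[P]_w f (l w / m) |%:E <=
   \int[P]_w ((l w) `^ (s / 2))%:E *
     ((m `^ s)^-1 * kappa * tau `^ (s / 2))%R%:E)%E.
Proof.
have [[M fM] _] := zf.
have [_ mH HM ->] := compound_poisson_expectation poisN ml l0 Nl iidX NX c cf fM.
set H := fun w => poisson_mixture P X f c (l w) in mH HM *.
have mfl : measurable_fun setT (fun w => f (l w / m)).
  apply: measurableT_comp; first exact: continuous_measurable_fun.
  exact: measurable_funM.
have iH : P.-integrable setT (EFin \o H) by exact: integrable_bounded mH HM.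
have ifl : P.-integrable setT (EFin \o (fun w => f (l w / m))).
  exact: integrable_bounded mfl (fun w => fM _).
rewrite -RintegralB// EFin_normr_Rintegral//; last first.
  apply: (@integrable_bounded _ _ _ _ _ (M + M)); first exact: measurable_funB.
  by move=> w; rewrite (le_trans (ler_normB _ _))// lerD.
apply: le_trans (le_abse_integral _ _ _) _ => //.
  by apply/measurable_EFinP; exact: measurable_funB.
have mp : measurable_fun setT (fun w => (l w `^ (s / 2))%:E).
  apply/measurable_EFinP.
  have mpow : measurable_fun setT (fun x : R => x `^ (s / 2)) by exact: measurable_powR.
  exact: (measurableT_comp mpow ml).
have C0 : 0 <= (m `^ s)^-1 * kappa * tau `^ (s / 2).
  apply: mulr_ge0; last exact: powR_ge0.
  by apply: mulr_ge0 Gamma_ratio_ge0; rewrite invr_ge0 powR_ge0.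
rewrite -ge0_integralZr//; last by move=> w _; rewrite lee_fin powR_ge0.
apply: ge0_le_integral => //.
- by apply: measurableT_comp => //; apply/measurable_EFinP; exact: measurable_funB.
- by apply: emeasurable_funM.
move=> w _; rewrite -EFinM /= lee_fin.
apply: (le_trans (poisson_mixture_approx (l0 w))).
have lw0 := ltW (l0 w); have t0 := ltW tau_gt0.
have m2 : 0 <= (m ^+ 2)^-1 by rewrite invr_ge0 exprn_ge0// ltW.
rewrite (powRM _ (mulr_ge0 lw0 t0) m2) (powRM _ lw0 t0).
have -> : (m ^+ 2)^-1 `^ (s / 2) = (m `^ s)^-1.
  rewrite -powR_invn ?(ltW m0)// -powRrM -powRN; congr (_ `^ _); lra.
by rewrite le_eqVlt; apply/orP; left; apply/eqP; ring.
Qed.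

End TransferBound.

(** * Passage to the supremum over test functions *)

Unset Implicit Arguments.

Theorem theorem1 (R : realType)
  (d : measure_display) (T : measurableType d) (P : probability T R)
  (d' : measure_display) (T' : measurableType d') (Q : probability T' R)
  (Lam : nat -> T -> R) (N : R -> T -> nat) (X : nat -> T -> R)
  (m : nat -> R) (L : T' -> R) (a sigma2 s : R) :
  (forall n, measurable_fun setT (Lam n)) ->
  (forall n w, 0 < Lam n w) ->
  poisson_process P N ->
  indep_sigma P (sigma_of [set t | 0 <= t] (fun t w => (N t w)%:R : R))
                (sigma_of setT Lam) ->
  iid P X ->
  P.-integrable setT (fun w => (X 0%N w)%:E) ->
  (\int[P]_w (X 0%N w)%:E = a%:E)%E ->
  a != 0 ->
  (\int[P]_w ((X 0%N w - a) ^+ 2)%:E = sigma2%:E)%E ->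
  (forall n, indep_sigma P
     (sigma_of [set: unit] (fun _ w => (N (Lam n w) w)%:R : R))
     (sigma_of setT X)) ->
  (forall n, 0 < m n) ->
  m @ \oo --> +oo%R ->
  measurable_fun setT L ->
  conv_distr P (fun n w => Lam n w / m n) Q L ->
  1 <= s <= 2 ->
  forall n : nat,
    (zolotarev s P (fun w => ((a * m n)^-1 * \sum_(j < N (Lam n w) w) X j w)%R) Q L
     <= (\int[P]_w (powR (Lam n w) (s / 2))%R%:E)
          * ((powR (m n) s)^-1 * (Gamma (1 + zol_alpha s) / Gamma (1 + s))
             * powR (1 + sigma2 / a ^+ 2) (s / 2))%R%:E
        + zolotarev s P (fun w => (Lam n w / m n)%R) Q L)%E.
Proof.
move=> mLam Lam0 poisN NLam iidX iX EX a0 VX NX m0 _ mL _ s12 n.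
have Nl (t : R) : 0 <= t -> indep2 P (fun w => (N t w)%:R) (Lam n).
  move=> t0 A B mA mB; apply: NLam.
    exact: (sigma_of_gen (X := fun t w => (N t w)%:R)).
  exact: sigma_of_gen.
have NXk k : indep2 P (fun w => (N (Lam n w) w)%:R) (fun w => \sum_(j < k) X j w).
  move=> A B mA mB; apply: (NX n).
    exact: (sigma_of_gen (X := fun (_ : unit) w => (N (Lam n w) w)%:R) (i := tt)).
  exact: sigma_of_sum.
apply: ge_ereal_sup => _ [f zf <-].
have bnd := zol_class_transfer_bound poisN (mLam n) (Lam0 n) Nl iidX iX EX a0 VX NXk (m0 n) s12 zf.
set A := \int[P]_w _ in bnd; set B := \int[P]_w _ in bnd.
set C := fine (\int[Q]_w (f (L w))%:E).
(* The same [f] serves in both terms: the first is bounded uniformly over the class, the second is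
   one member of the set defining the remaining distance. *)
apply: (@le_trans _ _ (`|A - B|%:E + `|B - C|%:E)%E).
  by rewrite -EFinD lee_fin ler_distD.
apply: leeD => //.
by apply: ereal_sup_ubound; exists f.
Qed.
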